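(* Let $A=(a_s)_{s\in S}\in(\mathbb{R}^d)^S$ be a finite vector configuration with oriented matroid $\mathcal{M}(A)$. For any realizable oriented building set $(\mathcal{B},\mathcal{M}(A))$, the acyclic nested complex of $(\mathcal{B},\mathcal{M}(A))$ is isomorphic to the boundary complex of the polar of the acyclonestohedron $\overline{\mathrm{Acyc}}(\mathcal{B},A)\subset\mathbb{R}A$.
   Context: For $A=(a_s)_{s\in S}$, $\mathbb{R}A\subseteq\mathbb{R}^d$ denotes its linear span, with the standard inner product $\langle\cdot|\cdot\rangle$. A dependence of $A$ is $\delta\in\mathbb{R}^S$ with $\sum_s\delta_s a_s=0$. The circuits of $A$ are the signatures $c=(c_+,c_-)=(\{s:\delta_s>0\},\{s:\delta_s<0\})$ of nonzero dependences $\delta$ of inclusion-minimal support $\underline{c}=c_+\cup c_-$. The oriented matroid $\mathcal{M}(A)$ is the combinatorial data given by these circuits; an oriented matroid of this form is called realizable. A building set on $S$ is a set $\mathcal{B}$ of non-empty subsets of $S$ containing all singletons and such that $B,B'\in\mathcal{B}$ with $B\cap B'\neq\varnothing$ implies $B\cup B'\in\mathcal{B}$. $\kappa(\mathcal{B})$ is the set of inclusion-maximal elements of $\mathcal{B}$. A nested set on $\mathcal{B}$ is a subset $\mathcal{N}\subseteq\mathcal{B}$ containing $\kappa(\mathcal{B})$ such that any two elements of $\mathcal{N}$ are nested or disjoint, and the union of any $k\ge2$ pairwise disjoint elements of $\mathcal{N}$ is not in $\mathcal{B}$. The pair $(\mathcal{B},\mathcal{M}(A))$ is an oriented building set if $\underline{c}\in\mathcal{B}$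 for every circuit $c$ of $A$; it is realizable since $\mathcal{M}(A)$ is. A nested set $\mathcal{N}$ on $\mathcal{B}$ is acyclic for $\mathcal{M}(A)$ if there is no circuit $c$ of $A$ and no subset $\mathcal{N}'\subseteq\mathcal{N}$ (possibly empty) with $c_+\not\subseteq\bigcup\mathcal{N}'$ while $c_-\subseteq\bigcup\mathcal{N}'$. Equivalently, for every $\mathcal{N}'\subseteq\mathcal{N}$ there is a linear form $f$ on $\mathbb{R}^d$ with $f(a_s)=0$ for $s\in\bigcup\mathcal{N}'$ and $f(a_s)>0$ for $s\in S\setminus\bigcup\mathcal{N}'$. The acyclic nested complex of $(\mathcal{B},\mathcal{M}(A))$ is the simplicial complex whose faces are the sets $\mathcal{N}\setminus\kappa(\mathcal{B})$ for all nested sets $\mathcal{N}$ on $\mathcal{B}$ that are acyclic for $\mathcal{M}(A)$. (If $A$ has a nonzero dependence with all coefficients $\ge0$, that is, if $\mathcal{M}(A)$ is not acyclic, then there is no acyclic nested set and this complex is empty.) Each circuit $c$ is the signature of a unique (up to positive rescaling) dependence $\delta$; set $r_c=\max_{s\in\underline{c}}|\delta_s|/\min_{s\in\underline{c}}|\delta_s|$. Let $R=|\mathcal{B}|\cdot\max_c r_c$, the maximum being over all circuits of $A$ (taken to be $1$ if there is no circuit). Let $\rho_B=0$ if $|B|=1$ and $\rho_B=R^{|B|}$ if $|B|\ge2$. For $B\in\mathcal{B}$ and $y\in\mathbb{R}A$, let $$\overline{g}_B(y)=\Bigl\langle\sum_{b\in B}a_b\Bigm|y\Bigr\rangle-\sum_{B'\in\mathcal{B},\,B'\subseteq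 B}\rho_{B'}.$$ The acyclonestohedron $\overline{\mathrm{Acyc}}(\mathcal{B},A)$ is the polytope in $\mathbb{R}A$ defined by the equalities $\overline{g}_B(y)=0$ for all $B\in\kappa(\mathcal{B})$ and the inequalities $\overline{g}_B(y)\ge0$ for all $B\in\mathcal{B}$. The boundary complex of the polar of a polytope $Q$ is, as a poset, the set of non-empty faces of $Q$ ordered by reverse inclusion ($Q$ itself corresponding to the empty face).
   Formalization: The formal theorem adds that every vector a_s is nonzero (no loops); with S={s}, a_s=0, B={{s}} the acyclic nested complex is empty while the acyclonestohedron is the point {0}, so the claim fails as stated. *)

(* Defs.v *)
From mathcomp Require Import all_boot all_order all_algebra.
From mathcomp Require Import boolp classical_sets functions reals.
(* Last, so that set0, cover and trivIset refer to finite sets. *)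
From mathcomp Require Import finset.

Set Implicit Arguments.
Unset Strict Implicit.
Unset Printing Implicit Defensive.

Import Order.TTheory GRing.Theory Num.Theory.
Local Open Scope ring_scope.

Section VectorConfigurations.
Context {R : realType} {S : finType} {d : nat}.
Implicit Types (A : S -> 'rV[R]_d) (delta : {ffun S -> R}).
Implicit Types (c : {set S} * {set S}).

Definition dotp (u v : 'rV[R]_d) : R := \sum_(i < d) u 0 i * v 0 i.

Definition linear_span A : {vspace 'rV[R]_d} := <<[seq A s | s : S]>>%VS.

Definition dependence A delta : Prop := \sum_s delta s *: A s = 0.

Definition dep_support delta : {set S} := [set s | delta s != 0].

Definition signature delta : {set S} * {set S} :=
  ([set s | 0 < delta s], [set s | delta s < 0]).

Definition circuit_dependence A delta : Prop :=
  [/\ dependence A delta, delta != 0 &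
      forall delta', dependence A delta' -> delta' != 0 ->
        dep_support delta' \subset dep_support delta ->
        dep_support delta' = dep_support delta].

Definition circuit A c : Prop :=
  exists2 delta, circuit_dependence A delta & signature delta = c.

Definition circuit_support c : {set S} := c.1 :|: c.2.

(* The dependence with signature c, normalized arbitrarily: it is unique up to
   a positive factor, which does not affect circuit_ratio. *)
Definition circuit_dep A c : {ffun S -> R} :=
  xget 0 (fun delta => circuit_dependence A delta /\ signature delta = c).

(* The default value of the minimum is the maximum, hence is neutral on the
   (nonempty) support of a circuit. *)
Definition circuit_ratio A c : R :=
  let delta := circuit_dep A c in
  let M := \big[Num.max/0]_(s in circuit_support c) `|delta s| in
  M / \big[Num.min/M]_(s in circuit_support c) `|delta s|.

(* All ratios are at least 1, so the default value 1 only matters when there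
   is no circuit. *)
Definition max_circuit_ratio A : R :=
  \big[Num.max/1]_(c : {set S} * {set S} | `[< circuit A c >])
    circuit_ratio A c.

End VectorConfigurations.

Section BuildingSets.
Context {S : finType}.
Implicit Types (BB N : {set {set S}}).

Definition building_set BB : Prop :=
  [/\ set0 \notin BB,
      forall s, [set s] \in BB &
      forall B B', B \in BB -> B' \in BB -> B :&: B' != set0 ->
        B :|: B' \in BB].

Definition kappa BB : {set {set S}} :=
  [set B | maxset (fun X => X \in BB) B].

Definition nested_set BB N : Prop :=
  [/\ N \subset BB, kappa BB \subset N,
      forall B B', B \in N -> B' \in N ->
        [\/ B \subset B', B' \subset B | [disjoint B & B']] &
      forall N', N' \subset N -> (2 <= #|N'|)%N -> trivIset N' ->
        cover N' \notin BB].

End BuildingSets.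

Section Acyclonestohedra.
Context {R : realType} {S : finType} {d : nat}.
Implicit Types (A : S -> 'rV[R]_d) (BB N : {set {set S}}).

Definition oriented_building_set BB A : Prop :=
  building_set BB /\ forall c, circuit A c -> circuit_support c \in BB.

Definition acyclic A N : Prop :=
  ~ exists c N', [/\ circuit A c, N' \subset N,
      ~~ (c.1 \subset cover N') & c.2 \subset cover N'].

Definition acyclic_nested_complex BB A : set {set {set S}} :=
  fun K => exists N, [/\ nested_set BB N, acyclic A N & K = N :\: kappa BB].

Definition radius BB A : R := #|BB|%:R * max_circuit_ratio A.

Definition rho BB A (B : {set S}) : R :=
  if (2 <= #|B|)%N then radius BB A ^+ #|B| else 0.

Definition gbar BB A (B : {set S}) (y : 'rV[R]_d) : R :=
  dotp (\sum_(b in B) A b) y - \sum_(B' in BB | B' \subset B) rho BB A B'.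

Definition acyclonestohedron BB A : set 'rV[R]_d :=
  fun y => [/\ y \in linear_span A,
    forall B, B \in kappa BB -> gbar BB A B y = 0 &
    forall B, B \in BB -> 0 <= gbar BB A B y].

(* Taking v = 0 and t = 0 shows that Q is a face of itself. *)
Definition face (Q F : set 'rV[R]_d) : Prop :=
  exists (v : 'rV[R]_d) (t : R),
    (forall y, Q y -> t <= dotp v y) /\
    F = (fun y => Q y /\ dotp v y = t).

Definition nonempty_faces (Q : set 'rV[R]_d) : set (set 'rV[R]_d) :=
  fun F => face Q F /\ (exists y, F y).

(* The boundary complex of the polar of Q is, as a poset, the set of nonempty
   faces of Q ordered by reverse inclusion, so that an isomorphism of K with it
   is an inclusion-reversing bijection between K and the nonempty faces. *)
Definition iso_polar_boundary (K : set {set {set S}}) (Q : set 'rV[R]_d) :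
    Prop :=
  exists phi : {set {set S}} -> set 'rV[R]_d,
    set_bij K (nonempty_faces Q) phi /\
    forall N N', K N -> K N' ->
      (N \subset N') <-> (phi N' `<=` phi N)%classic.

End Acyclonestohedra.

(* Main.v *)
Require Import Defs.
From mathcomp Require Import all_boot all_order all_algebra.
From mathcomp Require Import boolp classical_sets functions reals finset.
From mathcomp Require Import ring lra.

Set Implicit Arguments.
Unset Strict Implicit.
Unset Printing Implicit Defensive.

Import Order.TTheory GRing.Theory Num.Theory.
Local Open Scope ring_scope.

(** For [y] in the span of [A] put [x s := dotp (A s) y], and call a block [B]
    tight at [y] if [gbar BB A B y = 0].  The faces of a polytope are encoded by
    the tight sets of their relative interior points ([face_tight]), so the
    theorem reduces to the claim that the tight sets of the points of the
    acyclonestohedron are exactly the acyclic nested sets.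

    Tight sets are nested ([tight_prenested]): the right-hand sides of the
    inequalities are supermodular, and strictly so on crossing pairs of blocks,
    because [rho] is positive on blocks with at least two elements.  Tight sets
    are acyclic ([tight_blocks_acyclic]): [rho BB A B] grows so fast with the
    size of [B] that the mass which a violating circuit forces onto its
    positive part cannot be balanced, in the linear relation given by this
    circuit, by the mass of tight blocks, all of them smaller.

    Conversely, let [N] be an acyclic nested set. Acyclicity provides a linear
    form that is positive on the configuration ([positive_form]); its large
    multiples satisfy [0 <= gbar BB A B y] for all blocks [B]. Minimize, under
    these constraints, the sum of the functionals [dotp (\sum_(b in B) A b)] for
    [B] in [N]. At a minimizer, linear programming duality
    ([complementary_optimum]) writes this sum as a positive combination of the
    functionals of a family [M] of tight blocks, and [M] is again nested and
    acyclic. Now acyclic nested sets span cones with disjoint relative interiors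
    ([acyclic_cone_inj]), hence [N = M]: all members of [N] are tight at the
    minimizer. The same disjointness, with the lemma of Farkas, provides a
    direction in which all other tight blocks cease to be tight
    ([leaving_direction]).

    The disjointness of the cones also rests on acyclicity. A common point of
    two relative interiors gives two weight functions on [S] that differ by a
    dependence. Acyclicity implies that each weight attains its minimum over the
    support of a circuit on elements of both signs, and comparing the two minima
    along a circuit conforming to the dependence shows that the dependence
    vanishes. Finally, a nested set can be read off its weight function. *)

(** * The inner product *)

Section InnerProduct.
Context {R : realType}.

Lemma dotpE n (u v : 'rV[R]_n) : dotp u v = (u *m v^T) 0 0.
Proof. by rewrite mxE; apply: eq_bigr => i _; rewrite mxE. Qed.

Lemma dotpC n (u v : 'rV[R]_n) : dotp u v = dotp v u.
Proof. by apply: eq_bigr => i _; rewrite mulrC. Qed.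

Lemma dotpDl n (u v w : 'rV[R]_n) : dotp (u + v) w = dotp u w + dotp v w.
Proof. by rewrite !dotpE mulmxDl mxE. Qed.

Lemma dotpZl n a (u w : 'rV[R]_n) : dotp (a *: u) w = a * dotp u w.
Proof. by rewrite !dotpE -scalemxAl mxE. Qed.

Lemma dotpNl n (u w : 'rV[R]_n) : dotp (- u) w = - dotp u w.
Proof. by rewrite -scaleN1r dotpZl mulN1r. Qed.

Lemma dotp0l n (w : 'rV[R]_n) : dotp 0 w = 0.
Proof. by rewrite -[0](scale0r 0) dotpZl mul0r. Qed.

Lemma dotp_suml n (I : Type) (r : seq I) (P : pred I) (u : I -> 'rV[R]_n) w :
  dotp (\sum_(i <- r | P i) u i) w = \sum_(i <- r | P i) dotp (u i) w.
Proof.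
apply: (big_morph (fun u => dotp u w)) => [u1 u2|]; first exact: dotpDl.
exact: dotp0l.
Qed.

Lemma dotpDr n (w u v : 'rV[R]_n) : dotp w (u + v) = dotp w u + dotp w v.
Proof. by rewrite ![dotp w _]dotpC dotpDl. Qed.

Lemma dotpZr n a (w u : 'rV[R]_n) : dotp w (a *: u) = a * dotp w u.
Proof. by rewrite ![dotp w _]dotpC dotpZl. Qed.

Lemma dotpNr n (w u : 'rV[R]_n) : dotp w (- u) = - dotp w u.
Proof. by rewrite ![dotp w _]dotpC dotpNl. Qed.

Lemma dotp_sumr n (I : Type) (r : seq I) (P : pred I) (u : I -> 'rV[R]_n) w :
  dotp w (\sum_(i <- r | P i) u i) = \sum_(i <- r | P i) dotp w (u i).
Proof. by rewrite dotpC dotp_suml; apply: eq_bigr => i _; rewrite dotpC. Qed.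

Lemma dotp_row n (u v : 'rV[R]_n) (a b : 'rV[R]_1) :
  dotp (row_mx u a) (row_mx v b) = dotp u v + a 0 0 * b 0 0.
Proof.
rewrite dotpE tr_row_mx mul_row_col mxE -dotpE; congr (_ + _).
by rewrite mxE big_ord1 mxE.
Qed.

Lemma dotpp_eq0 n (u : 'rV[R]_n) : dotp u u = 0 -> u = 0.
Proof.
move=> /eqP; rewrite psumr_eq0 => [/allP uu0|i _]; last exact: sqr_ge0.
apply/rowP => i; rewrite mxE; apply/eqP.
by have := uu0 i; rewrite mem_index_enum mulf_eq0 orbb => /(_ isT).
Qed.

(** The orthogonal projection of [y] onto the span; it is found by solving the
    Gram system, whose rank is that of the configuration because the inner
    product is definite. *)
Lemma project_to_span n (S : finType) (A : S -> 'rV[R]_n) (y : 'rV[R]_n) :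
  exists2 y', y' \in linear_span A & forall s, dotp (A s) y' = dotp (A s) y.
Proof.
pose M := \matrix_(i < #|S|) A (enum_val i).
have rankG : \rank (M *m M^T) = \rank M.
  apply/eqP; rewrite eqn_leq mxrankM_maxl /=.
  have : (kermx (M *m M^T) <= kermx M)%MS.
    apply/row_subP => i; apply/sub_kermxP; set v := row i _.
    have vG : v *m (M *m M^T) = 0 by apply/sub_kermxP/row_sub.
    apply: dotpp_eq0; rewrite dotpE trmx_mul mulmxA -(mulmxA v M) vG mul0mx.
    by rewrite mxE.
  move/mxrankS; rewrite !mxrank_ker.
  have := rank_leq_row M; have := rank_leq_row (M *m M^T).
  by move=> r1 r2; rewrite leq_sub2lE.
have : (y *m M^T <= M *m M^T)%MS.
  apply: submx_trans (submxMl y _) _.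
  rewrite -(geq_leqif (mxrank_leqif_sup (submxMl M M^T))).
  by rewrite rankG mxrank_tr.
case/submxP => x xE; exists (x *m M).
  rewrite mulmx_sum_row; apply: memv_suml => i _; apply: memvZ.
  by rewrite rowK; apply: memv_span; apply: map_f; rewrite mem_enum.
move=> s; rewrite ![dotp (A s) _]dotpC.
have dotM z : dotp z (A s) = (z *m M^T) 0 (enum_rank s).
  by rewrite mxE; apply: eq_bigr => j _; rewrite !mxE enum_rankK.
by rewrite !dotM -mulmxA xE.
Qed.

End InnerProduct.

(** * Linear inequalities *)

Section LinearInequalities.
Context {R : realType} {I : finType}.

(** Induction on the number of generators.  If the hypothesis fails without
    the generator [u i0], a witness [x] of this failure has [dotp (u i0) x < 0];
    projecting along [x] onto the hyperplane orthogonal to [u i0] removes that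
    generator. *)
Lemma farkas n (P : {set I}) (u : I -> 'rV[R]_n) (w : 'rV[R]_n) :
  (forall z, (forall i, i \in P -> 0 <= dotp (u i) z) -> 0 <= dotp w z) ->
  exists2 mu : I -> R, (forall i, 0 <= mu i) & w = \sum_(i in P) mu i *: u i.
Proof.
have [k] := ubnP #|P|; elim: k => // k IHk in P u w *.
rewrite ltnS => Pk wP; have [P0|[i0 Pi0]] := set_0Vmem P.
  exists (fun=> 0) => //; rewrite P0 big_set0; apply: dotpp_eq0; apply/eqP.
  rewrite eq_le; apply/andP; split; last by apply: wP => i; rewrite P0 inE.
  by rewrite -oppr_ge0 -dotpNr; apply: wP => i; rewrite P0 inE.
have Pk' : (#|P :\ i0| < k)%N by apply: leq_trans Pk; rewrite [leqRHS](cardsD1 i0) Pi0.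
pose wP' := forall z, (forall i, i \in P :\ i0 -> 0 <= dotp (u i) z) -> 0 <= dotp w z.
case: (pselect wP') => [/(IHk _ _ _ Pk')[mu mu0 ->]|].
  exists (fun i => if i == i0 then 0 else mu i) => [i|]; first by case: eqP.
  rewrite [RHS](big_setD1 i0) //= eqxx scale0r add0r.
  by apply: eq_bigr => i; rewrite !inE => /andP[/negPf-> _].
move=> /existsNP[x /not_implyP[xP /negP]]; rewrite -ltNge => wx.
have u0x : dotp (u i0) x < 0.
  rewrite ltNge; apply/negP => u0x; move: wx; rewrite ltNge => /negP; apply.
  by apply: wP => i Pi; have [->|ii0] := eqVneq i i0; last by apply: xP; rewrite !inE ii0.
pose t v := dotp v x / dotp (u i0) x.
pose u' i := u i - t (u i) *: u i0; pose w' := w - t w *: u i0.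
have [z zP|mu mu0 w'E] := IHk (P :\ i0) u' w' Pk'.
  pose z' := z - (dotp (u i0) z / dotp (u i0) x) *: x.
  have z'E v : dotp (v - t v *: u i0) z = dotp v z'.
    rewrite dotpDl dotpNl dotpZl dotpDr dotpNr dotpZr /t; congr (_ - _).
    by ring.
  rewrite z'E; apply: wP => i Pi; have [->|ii0] := eqVneq i i0.
    by rewrite dotpDr dotpNr dotpZr divfK ?subrr // lt_eqF.
  by rewrite -z'E; apply: zP; rewrite !inE ii0.
pose m := t w - \sum_(i in P :\ i0) mu i * t (u i).
have m0 : 0 <= m.
  rewrite subr_ge0; apply: (@le_trans _ _ 0).
    apply: sumr_le0 => i iP; rewrite mulr_ge0_le0 //.
    by rewrite mulr_ge0_le0 ?invr_le0 ?(ltW u0x) // xP.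
  by rewrite mulr_le0 ?invr_le0 ?(ltW u0x) // ltW.
exists (fun i => if i == i0 then m else mu i) => [i|]; first by case: eqP.
rewrite (big_setD1 i0) //= eqxx.
have -> : \sum_(i in P :\ i0) (if i == i0 then m else mu i) *: u i =
    w' + (\sum_(i in P :\ i0) mu i * t (u i)) *: u i0.
  rewrite w'E scaler_suml -big_split /=; apply: eq_bigr => i.
  rewrite !inE => /andP[/negPf-> _].
  by rewrite /u' scalerBr scalerA subrK.
by rewrite addrCA -scalerDl subrK subrK.
Qed.

Lemma farkas_alt n (P : {set I}) (u : I -> 'rV[R]_n) (w : 'rV[R]_n) :
  (exists2 mu : I -> R, (forall i, 0 <= mu i) & w = \sum_(i in P) mu i *: u i) \/
  (exists2 z, forall i, i \in P -> 0 <= dotp (u i) z & dotp w z < 0).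
Proof.
case: (pselect (exists2 z, forall i, i \in P -> 0 <= dotp (u i) z & dotp w z < 0)).
  by right.
move=> noz; left; apply: farkas => z zP; rewrite leNgt; apply/negP => wz.
by apply: noz; exists z.
Qed.

Lemma sum_indicator n (P N : {set I}) (u : I -> 'rV[R]_n) : N \subset P ->
  \sum_(i in P) (i \in N)%:R *: u i = \sum_(i in N) u i.
Proof.
move=> NP; rewrite (bigID [in N]) /= [X in _ + X]big1 ?addr0; last first.
  by move=> i /andP[_ /negPf->]; rewrite scale0r.
rewrite (eq_bigl [in N]) => [|i].
  by apply: eq_bigr => i ->; rewrite scale1r.
by rewrite andbC; apply: andb_idr; apply: (fintype.subsetP NP).
Qed.

Lemma sum_positive_part n (P : {set I}) (mu : I -> R) (u : I -> 'rV[R]_n) :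
  (forall i, 0 <= mu i) ->
  \sum_(i in P) mu i *: u i = \sum_(i in [set i in P | 0 < mu i]) mu i *: u i.
Proof.
move=> mu0; rewrite (bigID (fun i => 0 < mu i)) /= [X in _ + X]big1 ?addr0.
  by apply: eq_bigl => i; rewrite inE.
move=> i /andP[_]; rewrite -leNgt => mui.
by have -> : mu i = 0; [apply/eqP; rewrite eq_le mui mu0 | rewrite scale0r].
Qed.

End LinearInequalities.

Section LinearProgramming.
Context {R : realType} {I : finType} {n : nat}.
Variables (P : {set I}) (u : I -> 'rV[R]_n) (b : I -> R).

Definition feasible y := forall i, i \in P -> b i <= dotp (u i) y.

(** Non-tight constraints survive a small enough step in any direction. *)
Lemma feasible_step y z : feasible y ->
  (forall i, i \in P -> dotp (u i) y = b i -> 0 <= dotp (u i) z) ->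
  exists e : R, [/\ 0 < e, feasible (y + e *: z) &
    forall i, i \in P -> dotp (u i) (y + e *: z) = b i ->
      dotp (u i) y = b i /\ dotp (u i) z = 0].
Proof.
move=> yP zP.
pose q i := (dotp (u i) y - b i) / (1 + `|dotp (u i) z|).
pose e := \big[Num.min/1]_(i in P | b i < dotp (u i) y) q i.
have den i : 0 < 1 + `|dotp (u i) z| by rewrite ltr_wpDr.
have e0 : 0 < e.
  apply/bigmin_gtP; split => // i /andP[_ bi]; rewrite divr_gt0 // subr_gt0 //.
have slack i : i \in P -> b i < dotp (u i) y -> b i < dotp (u i) (y + e *: z).
  move=> Pi bi; have : e <= q i by apply: bigmin_le_cond; rewrite Pi.
  rewrite /q ler_pdivlMr // dotpDr dotpZr mulrDr mulr1 => eq.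
  have : - (e * `|dotp (u i) z|) <= e * dotp (u i) z.
    by rewrite -mulrN ler_pM2l // lerNl -normrN ler_norm.
  by move: e0 eq; lra.
have tight i : i \in P -> dotp (u i) y = b i ->
    dotp (u i) (y + e *: z) = b i + e * dotp (u i) z.
  by move=> _ bi; rewrite dotpDr dotpZr bi.
exists e; split => // i Pi.
  have [bi|bi] := eqVneq (dotp (u i) y) (b i).
    by rewrite tight // lerDl mulr_ge0 ?(ltW e0) // zP.
  by apply/ltW/slack => //; rewrite lt_neqAle eq_sym bi yP.
have [bi|bi] := eqVneq (dotp (u i) y) (b i).
  rewrite tight // -[RHS]addr0 => /addrI /eqP; rewrite mulf_eq0.
  by rewrite gt_eqF //= => /eqP.
move=> bi'; have := slack i Pi.
by rewrite bi' ltxx lt_neqAle eq_sym bi yP //= => /(_ isT).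
Qed.

(** An infeasible linear bound [dotp w y <= c] on a feasible system is
    refuted by a nonnegative combination of the constraints, with a definite
    gap; this is the lemma of Farkas for the homogenized system. *)
Lemma infeasible_gap (w : 'rV[R]_n) (c : R) :
  (forall y, feasible y -> c < dotp w y) ->
  exists2 t : R, 0 <= t & forall y, feasible y -> 1 <= t * (dotp w y - c).
Proof.
move=> wc.
(* The last coordinate homogenizes; None indexes the bound on the objective. *)
pose P' : {set option I} := None |: [set Some i | i in P].
pose u' (o : option I) : 'rV[R]_(n + 1) :=
  if o is Some i then row_mx (u i) (const_mx (- b i)) else row_mx (- w) (const_mx c).
have [[mu mu0 muE]|[z zP]] := farkas_alt P' u' (row_mx 0 (const_mx (-1))).
  exists (mu None) => // y yP.
  have := congr1 (fun v => dotp v (row_mx y (const_mx 1))) muE.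
  rewrite dotp_row dotp0l !mxE add0r mulr1 dotp_suml big_setU1 /=; last first.
    by apply/imsetP => -[].
  rewrite big_imset /=; last by move=> i j _ _ [].
  rewrite dotpZl dotp_row dotpNl !mxE mulr1.
  set s := (X in _ = _ + X); have s0 : 0 <= s.
    apply: sumr_ge0 => i Pi; rewrite dotpZl dotp_row !mxE mulr1 mulr_ge0 //.
    by rewrite subr_ge0 yP.
  by rewrite -opprB mulrN; lra.
rewrite -(hsubmxK z) dotp_row dotp0l !mxE add0r mulN1r oppr_lt0.
set y := lsubmx z; set t := z 0 _ => t0.
have zE i : i \in P' -> 0 <= dotp (u' i) (row_mx y (const_mx t)).
  move=> /zP; rewrite -[in X in X -> _](hsubmxK z).
  congr (is_true (_ <= dotp _ (row_mx _ _))).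
  by apply/rowP => j; rewrite !mxE (ord1 j).
have : feasible (t^-1 *: y).
  move=> i Pi; have := zE (Some i); rewrite !inE /= (imset_f _ Pi) => /(_ isT).
  rewrite dotp_row !mxE dotpZr mulNr subr_ge0 => h.
  by rewrite mulrC ler_pdivlMr.
move=> /wc; have := zE None; rewrite !inE => /(_ isT).
rewrite dotp_row !mxE dotpZr dotpNl addrC subr_ge0 mulrC => h.
by rewrite mulrC ltr_pdivlMr // ltNge mulrC h.
Qed.

(** An optimal solution of the program minimizing [dotp w y]: the infimum is
    attained because otherwise [infeasible_gap] would improve it, and at a
    minimizer the multipliers exist because otherwise [farkas_alt] would
    produce a descent direction. *)
Lemma complementary_optimum (w : 'rV[R]_n) (lam : I -> R) :
  (exists y, feasible y) ->
  (forall i, 0 <= lam i) -> w = \sum_(i in P) lam i *: u i ->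
  exists y (mu : I -> R), [/\ feasible y, forall i, 0 <= mu i,
    w = \sum_(i in P) mu i *: u i &
    forall i, i \in P -> 0 < mu i -> dotp (u i) y = b i].
Proof.
move=> [y0 y0P] lam0 wE.
pose E : set R := fun r => exists2 y, feasible y & dotp w y = r.
have E0 : has_inf E.
  split; first by exists (dotp w y0), y0.
  exists (\sum_(i in P) lam i * b i) => _ [y yP <-].
  rewrite wE dotp_suml; apply: ler_sum => i Pi.
  by rewrite dotpZl ler_wpM2l // yP.
have infE y : feasible y -> inf E <= dotp w y.
  by move=> yP; apply: ge_inf; [case: E0|exists y].
have [y yP ymin] : exists2 y, feasible y & dotp w y <= inf E.
  apply: contrapT => noy.
  have [y yP|t t0 gap] := @infeasible_gap w (inf E).
    by rewrite ltNge; apply/negP => wy; apply: noy; exists y.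
  have tpos : 0 < t.
    rewrite lt_neqAle t0 andbT; apply/eqP => t00.
    by have := gap _ y0P; rewrite -t00 mul0r ler10.
  have [|_ [y yP <-]] := @inf_adherent _ E t^-1 _ E0; first by rewrite invr_gt0.
  have := gap _ yP; rewrite mulrC -ler_pdivrMr // div1r lerBrDl => h.
  by rewrite ltNge h.
have [[mu mu0 muE]|[z zT wz]] :=
    farkas_alt [set i in P | dotp (u i) y == b i] u w.
  exists y, (fun i => if dotp (u i) y == b i then mu i else 0); split => //.
  - by move=> i; case: ifP.
  - rewrite muE (eq_bigl (fun i => (i \in P) && (dotp (u i) y == b i))).
      by rewrite big_mkcondr /=; apply: eq_bigr => i _; case: ifP; rewrite ?scale0r.
    by move=> i; rewrite inE.
  - by move=> i _; case: eqP => //; rewrite ltxx.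
have [i Pi ui|e [e0 yzP _]] := @feasible_step y z yP.
  by apply: zT; rewrite inE Pi ui eqxx.
have := infE _ yzP; rewrite dotpDr dotpZr => h.
have : e * dotp w z < 0 by rewrite nmulr_llt0.
by lra.
Qed.

End LinearProgramming.

(** * Circuits *)

Section Circuits.
Context {R : realType} {S : finType} {d : nat}.
Variable A : S -> 'rV[R]_d.

Lemma circuit_opp c : circuit A c -> circuit A (c.2, c.1).
Proof.
case=> delta [delta_dep delta0 delta_min] <-.
have suppN (eta : {ffun S -> R}) : dep_support (- eta) = dep_support eta.
  by apply/setP => s; rewrite !inE ffunE oppr_eq0.
exists (- delta); first split.
- rewrite /dependence; under eq_bigr do rewrite ffunE scaleNr.
  by rewrite sumrN delta_dep oppr0.
- by rewrite oppr_eq0.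
- by move=> eta; rewrite suppN; apply: delta_min.
by congr (_, _); apply/setP => s; rewrite !inE ffunE ?oppr_gt0 ?oppr_lt0.
Qed.

Lemma circuit_support_signature (delta : {ffun S -> R}) :
  circuit_support (signature delta) = dep_support delta.
Proof. by apply/setP => s; rewrite !inE neq_lt orbC. Qed.

(** A nonzero dependence of minimal support among those that conform to
    [delta] is a circuit: a dependence of smaller support could be subtracted
    from it until a first coordinate vanishes, without any sign change. *)
Lemma conformal_circuit (delta : {ffun S -> R}) :
  dependence A delta -> delta != 0 ->
  exists c, [/\ circuit A c, c.1 \subset [set s | 0 < delta s] &
    c.2 \subset [set s | delta s < 0]].
Proof.
pose conf (eta : {ffun S -> R}) := forall s,
  (0 < eta s -> 0 < delta s) /\ (eta s < 0 -> delta s < 0).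
move=> delta_dep delta0.
pose good k := `[< exists eta, [/\ dependence A eta, eta != 0, conf eta &
  #|dep_support eta| = k] >].
have exgood : exists k, good k.
  by exists #|dep_support delta|; apply/asboolP; exists delta.
case: (ex_minnP exgood) => k /asboolP[eta [eta_dep eta0 eta_conf <-]] etamin.
exists (signature eta); split; last 2 first.
- by apply/fintype.subsetP => s; rewrite !inE; case: (eta_conf s).
- by apply/fintype.subsetP => s; rewrite !inE; case: (eta_conf s).
exists eta => //; split => // th th_dep th0 th_sub.
apply/eqP; rewrite eqEsubset th_sub /=; apply/negPn/negP => eta_sub.
have [s0 ths0] : exists s, s \in dep_support th.
  apply/existsP; apply: contraNT th0; rewrite negb_exists => /forallP th0.
  by apply/eqP/ffunP => s; have := th0 s; rewrite !inE negbK ffunE => /eqP.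
pose q s := `|eta s| / `|th s|.
(* As the norm of t grows, eta - t *: th vanishes first at s1. *)
case: (@Order.TotalTheory.arg_minP _ _ _ s0 [in dep_support th] q ths0) => s1 s1P s1min.
have ths1 : th s1 != 0 by move: s1P; rewrite !inE.
pose t := eta s1 / th s1.
pose eta' : {ffun S -> R} := [ffun s => eta s - t * th s].
have tth s : `|t * th s| <= `|eta s|.
  rewrite normrM normf_div; have [->|ths] := eqVneq (th s) 0.
    by rewrite normr0 mulr0.
  by rewrite -ler_pdivlMr ?normr_gt0 //; apply: s1min; rewrite inE.
have eta'_conf : conf eta'.
  move=> s; rewrite ffunE; have [P1 P2] := eta_conf s; have := tth s.
  have := ler_norm (t * th s); have := ler_norm (- (t * th s)); rewrite normrN.
  have [h|h|h] := ltrgt0P (eta s); split => ?; rewrite ?P1 ?P2 //; lra.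
have eta's1 : eta' s1 = 0 by rewrite ffunE divfK ?subrr.
have : (#|dep_support eta'| < #|dep_support eta|)%N.
  apply: proper_card; apply/properP; split.
    apply/fintype.subsetP => s; rewrite !inE ffunE; apply: contraNneq => es.
    have := tth s; rewrite es normr0 normr_le0 => /eqP->; rewrite subr0 //.
  by exists s1; [apply: (fintype.subsetP th_sub) | rewrite inE eta's1 eqxx].
rewrite ltnNge => /negP; apply; apply: etamin; apply/asboolP.
exists eta'; split => //.
- rewrite /dependence; under eq_bigr do rewrite ffunE scalerBl -scalerA.
  by rewrite sumrB -scaler_sumr eta_dep th_dep scaler0 subr0.
- move/subsetPn: eta_sub => [s]; rewrite !inE negbK => es /eqP ths.
  by apply: contraNneq es => /ffunP/(_ s); rewrite !ffunE ths mulr0 subr0 => ->.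
Qed.

Lemma circuit_card2 c : (forall s, A s <> 0) -> circuit A c ->
  (2 <= #|circuit_support c|)%N.
Proof.
move=> A0 [delta [delta_dep delta0 _] <-]; rewrite circuit_support_signature.
have [supp0|[s sP]] := set_0Vmem (dep_support delta).
  case/eqP: delta0; apply/ffunP => s; rewrite ffunE.
  by have := in_set0 s; rewrite -supp0 inE => /negbFE/eqP.
rewrite ltnNge; apply/negP => card1.
have suppE : dep_support delta = [set s].
  by apply/esym/eqP; rewrite eqEcard sub1set sP cards1.
move: delta_dep; rewrite /dependence (bigD1 s) //= big1 ?addr0; last first.
  move=> t ts; apply/eqP; rewrite scaler_eq0; apply/orP; left; apply/negPn.
  by move: ts; rewrite -in_set1 -suppE inE.
by move/eqP; rewrite scaler_eq0 => /orP[/eqP d0|/eqP/A0//]; move: sP; rewrite inE d0 eqxx.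
Qed.

(** For nonnegative solutions [x] of the linear dependences, each side of a
    circuit is dominated by the other one up to the circuit ratio. *)
Lemma circuit_ratio_bound c (x : S -> R) : circuit A c ->
  (forall s, 0 <= x s) ->
  (forall delta : {ffun S -> R}, dependence A delta -> \sum_s delta s * x s = 0) ->
  \sum_(s in c.1) x s <= max_circuit_ratio A * \sum_(s in c.2) x s.
Proof.
move=> c_circ x0 xdep.
have : circuit_ratio A c <= max_circuit_ratio A.
  by apply: (le_bigmax_cond 1 (circuit_ratio A)); apply/asboolP.
rewrite /circuit_ratio; set delta := circuit_dep A c.
have [[delta_dep delta0 _] sigE] :
    circuit_dependence A delta /\ signature delta = c.
  by have [dl dlc dls] := c_circ; have /= := @xgetPex _ 0
      (fun dl => circuit_dependence A dl /\ signature dl = c); apply; exists dl.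
set M := \big[Num.max/0]_(s in _) _; set m := \big[Num.min/M]_(s in _) _ => le_r.
have suppE : circuit_support c = dep_support delta.
  by rewrite -sigE circuit_support_signature.
have Mle s : s \in circuit_support c -> `|delta s| <= M.
  by move=> sc; apply: (le_bigmax_cond 0 (fun s => `|delta s|)).
have mge s : s \in circuit_support c -> m <= `|delta s|.
  by move=> sc; apply: (bigmin_le_cond M (fun s => `|delta s|)).
have pos s : s \in circuit_support c -> 0 < `|delta s|.
  by rewrite suppE inE normr_gt0.
have m0 : 0 < m.
  apply/bigmin_gtP; split => //.
  have [s sc] : exists s, s \in circuit_support c.
    apply/existsP; apply: contraNT delta0; rewrite negb_exists => /forallP n0.
    by apply/eqP/ffunP => s; have := n0 s; rewrite suppE inE negbK ffunE => /eqP.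
  exact: lt_le_trans (pos s sc) (Mle s sc).
apply: le_trans (_ : M / m * \sum_(s in c.2) x s <= _); last first.
  by rewrite ler_wpM2r // sumr_ge0.
rewrite mulrAC ler_pdivlMr // mulrC !mulr_sumr.
have c1E s : (s \in c.1) = (0 < delta s) by rewrite -sigE inE.
have c2E s : (s \in c.2) = (delta s < 0) by rewrite -sigE inE.
have := xdep _ delta_dep.
rewrite (bigID [in c.1]) /= [X in _ + X](bigID [in c.2]) /=.
rewrite [X in _ + (_ + X)]big1 ?addr0 => [|s /andP[]]; last first.
  by rewrite c1E c2E; have [||->] := ltrgt0P (delta s); rewrite ?mul0r.
rewrite [X in _ + X](eq_bigl [in c.2]) => [|s]; last first.
  by rewrite c1E c2E; have [] := ltrgt0P (delta s).
move/eqP; rewrite addr_eq0 => /eqP sumE.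
apply: (@le_trans _ _ (\sum_(s in c.1) delta s * x s)).
  apply: ler_sum => s s1; rewrite ler_wpM2r //.
  by have := mge s; rewrite inE s1 gtr0_norm -?c1E // => ->.
rewrite sumE -sumrN; apply: ler_sum => s s2; rewrite -mulNr ler_wpM2r //.
by have := Mle s; rewrite inE s2 orbT ltr0_norm -?c2E // => ->.
Qed.

End Circuits.

(** * Nested families *)

Section NestedFamilies.
Context {S : finType}.
Implicit Types (BB N X : {set {set S}}) (B C U : {set S}).

(** Nested sets without the requirement of containing the maximal blocks:
    unlike nested sets, these are closed under taking subfamilies. *)
Definition prenested BB N : Prop :=
  [/\ N \subset BB,
      forall B B', B \in N -> B' \in N ->
        [\/ B \subset B', B' \subset B | [disjoint B & B']] &
      forall N', N' \subset N -> (2 <= #|N'|)%N -> trivIset N' ->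
        cover N' \notin BB].

Lemma nested_setE BB N :
  nested_set BB N <-> prenested BB N /\ kappa BB \subset N.
Proof. by split=> [[]|[[]]]; split. Qed.

Lemma prenested_sub BB N N' : prenested BB N -> N' \subset N -> prenested BB N'.
Proof.
case=> NBB lam un N'N; split.
- exact: fintype.subset_trans N'N NBB.
- by move=> B B' BN BN'; apply: lam; apply: (fintype.subsetP N'N).
- by move=> N2 N2N'; apply: un; apply: fintype.subset_trans N2N' N'N.
Qed.

Lemma kappa_sub N : kappa N \subset N.
Proof. by apply/fintype.subsetP => B; rewrite inE => /maxsetp. Qed.

Lemma sub_kappa N B : B \in N -> exists2 B', B' \in kappa N & B \subset B'.
Proof. by case/(@maxset_exists _ [in N]) => B' B'P BB'; exists B'; rewrite ?inE. Qed.

Lemma cover_kappa N : cover (kappa N) = cover N.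
Proof.
apply/eqP; rewrite eqEsubset; apply/andP; split; apply/bigcupsP => B BN.
  by apply: bigcup_sup; apply: (fintype.subsetP (kappa_sub N)).
have [B' B'N BB'] := sub_kappa BN.
exact: fintype.subset_trans BB' (bigcup_sup _ B'N).
Qed.

Lemma kappa_eq N B B' : B \in kappa N -> B' \in N -> B \subset B' -> B' = B.
Proof. by rewrite inE => /maxsetP[_ Bmax]; apply: Bmax. Qed.

Lemma trivIset_kappa BB N : prenested BB N -> trivIset (kappa N).
Proof.
move=> [_ lam _]; apply/trivIsetP => B B' BN B'N neq.
have BN1 := fintype.subsetP (kappa_sub N) _ BN.
have BN2 := fintype.subsetP (kappa_sub N) _ B'N.
have [BB'|BB'|//] := lam _ _ BN1 BN2.
  by rewrite (kappa_eq BN BN2 BB') eqxx in neq.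
by rewrite (kappa_eq B'N BN1 BB') eqxx in neq.
Qed.

Section Building.
Variables (BB : {set {set S}}) (BBP : building_set BB).

Lemma building_neq0 B : B \in BB -> B != set0.
Proof. by case: BBP => BB0 _ _; apply: contraTneq => ->. Qed.

Lemma union_meeting C X : C \in BB -> X \subset BB ->
  (forall B, B \in X -> B :&: C != set0) -> C :|: cover X \in BB.
Proof.
move=> CB XB XC; have [_ _ un] := BBP; rewrite /cover.
apply: (big_rec (fun U => C :|: U \in BB)); first by rewrite setU0.
move=> B U BX CU; rewrite setUCA setUC; apply: un => //.
  exact: (fintype.subsetP XB).
have /set0Pn[s] := XC _ BX; rewrite inE => /andP[sB sC].
by apply/set0Pn; exists s; rewrite !inE sB sC.
Qed.

(** Every block [C] has a point that lies in no member of a nested family but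
    those containing [C]: otherwise [C] would glue the maximal members that it
    meets into a single block. *)
Lemma generic_point N C : prenested BB N -> C \in BB ->
  ~~ (C \subset cover [set B in N | ~~ (C \subset B)]).
Proof.
move=> NP CB; set N' := finset _; apply/negP => CN'.
have N'N : N' \subset N by apply/fintype.subsetP => B; rewrite inE => /andP[].
have N'P := prenested_sub NP N'N.
pose X := [set B in kappa N' | B :&: C != set0].
have Xk : X \subset kappa N' by apply/fintype.subsetP => B; rewrite inE => /andP[].
have XN' := fintype.subset_trans Xk (kappa_sub N').
have CX : C \subset cover X.
  apply/fintype.subsetP => s sC; have := fintype.subsetP CN' s sC.
  rewrite -cover_kappa => /bigcupP[B Bk sB]; apply/bigcupP; exists B => //.
  by rewrite inE Bk; apply/set0Pn; exists s; rewrite inE sB.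
have XB : cover X \in BB.
  have /setUidPr <- := CX; apply: union_meeting => //; last first.
    by move=> B; rewrite inE => /andP[].
  by have [N'BB _ _] := N'P; apply: fintype.subset_trans XN' N'BB.
have [X2|] := leqP 2 #|X|.
  have [_ _ /(_ X XN' X2)] := N'P.
  by rewrite XB => /(_ (trivIsetS Xk (trivIset_kappa N'P))).
rewrite ltnS leq_eqVlt ltnS leqn0 => /orP[/cards1P[B XE]|].
  have : B \in N' by apply: (fintype.subsetP XN'); rewrite XE inE.
  by rewrite inE => /andP[_ /negP]; apply; move: CX; rewrite XE /cover big_set1.
rewrite cards_eq0 => /eqP X0; move: (building_neq0 XB).
by rewrite X0 /cover big_set0 eqxx.
Qed.

End Building.
End NestedFamilies.

(** * Tight blocks *)

Section TightBlocks.
Context {R : realType} {S : finType}.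
Variables (BB : {set {set S}}) (BBP : building_set BB).
Variables (r : {set S} -> R) (x : S -> R).
Implicit Types (B C U : {set S}) (X : {set {set S}}).
Hypothesis r_ge0 : forall B, 0 <= r B.
Hypothesis r_gt0 : forall B, (2 <= #|B|)%N -> 0 < r B.
Hypothesis x_ge0 : forall s, 0 <= x s.

(** The right-hand side of the inequality of a block, extended to all subsets
    because an intersection of blocks need not be a block. *)
Definition load U := \sum_(B in BB | B \subset U) r B.
Definition mass U := \sum_(s in U) x s.

Local Notation F := load.

Hypothesis load_le : forall B, B \in BB -> F B <= mass B.

Lemma mass_sub U U' : U \subset U' -> mass U <= mass U'.
Proof.
move=> UU'; rewrite /mass [leRHS](big_setID U) /= (setIidPr UU').
by rewrite lerDl sumr_ge0.
Qed.

(** A block lies in at most one member of a disjoint family. *)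
Lemma sum_disjoint_blocks X : trivIset X ->
  \sum_(B in X) F B = \sum_(B in BB | [exists C in X, B \subset C]) r B.
Proof.
move=> tX; rewrite /load.
rewrite (exchange_big_dep (fun B => (B \in BB) && [exists C in X, B \subset C])) /=.
  apply: eq_bigr => B /andP[BBB /exists_inP[C CX BC]].
  rewrite (big_pred1 C) // => D; rewrite BBB /=.
  apply/andP/eqP => [[DX BD]|->]; last by [].
  apply/eqP/negPn/negP => DC.
  have := trivIsetP tX _ _ DX CX DC; rewrite -setI_eq0 => /eqP DC0.
  have /set0Pn[s sB] := building_neq0 BBP BBB.
  have := in_set0 s; rewrite -DC0 inE.
  by rewrite (fintype.subsetP BD) // (fintype.subsetP BC).
by move=> C B CX /andP[-> BC]; apply/exists_inP; exists C.
Qed.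

(** The maximal blocks inside [U] are disjoint, and every block inside [U] lies
    in one of them; so the inequalities of blocks extend to [U]. *)
Lemma load_le_mass U : F U <= mass U.
Proof.
pose N := [set B in BB | B \subset U].
have NB B : B \in N -> B \in BB by rewrite inE => /andP[].
have NU B : B \in N -> B \subset U by rewrite inE => /andP[].
have kN B : B \in kappa N -> B \in N by apply: (fintype.subsetP (kappa_sub N)).
have tk : trivIset (kappa N).
  apply/trivIsetP => B C Bk Ck; apply: contraNT; rewrite -setI_eq0 => BC.
  have UN : B :|: C \in N.
    have [_ _ un] := BBP.
    by rewrite inE un ?NB ?kN // subUset !NU ?kN.
  by rewrite -(kappa_eq Bk UN (subsetUl _ _)) (kappa_eq Ck UN (subsetUr _ _)).
apply: (@le_trans _ _ (\sum_(B in kappa N) F B)).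
  rewrite sum_disjoint_blocks // /load le_eqVlt; apply/orP; left; apply/eqP.
  apply: eq_bigl => B; case BBB: (B \in BB) => //=.
  apply/idP/exists_inP => [BU|[C /kN/NU CU BC]].
    have [|C Ck BC] := @sub_kappa _ N B; first by rewrite inE BBB.
    by exists C.
  exact: fintype.subset_trans BC CU.
apply: (@le_trans _ _ (mass (cover (kappa N)))).
  by rewrite /mass big_trivIset //; apply: ler_sum => B /kN/NB; apply: load_le.
by apply: mass_sub; apply/bigcupsP => B /kN/NU.
Qed.

Lemma load_supermodular B C : B \in BB -> C \in BB -> B :&: C != set0 ->
  ~~ (B \subset C) -> ~~ (C \subset B) ->
  F B + F C + r (B :|: C) <= F (B :&: C) + F (B :|: C).
Proof.
move=> BBB CBB BC0 nBC nCB; have [_ _ un] := BBP.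
have -> : r (B :|: C) = \sum_(D in BB | D == B :|: C) r D.
  rewrite (big_pred1 (B :|: C)) // => D /=.
  by apply: andb_idl => /eqP->; rewrite un.
rewrite /load 5!big_mkcondr /= -!big_split /=; apply: ler_sum => D _.
rewrite subsetI; have [->|_] := eqVneq D (B :|: C).
  rewrite !subUset (negPf nBC) (negPf nCB) andbF /= subsetUl subsetUr /=.
  by rewrite !add0r.
have DB : D \subset B -> D \subset B :|: C.
  by move=> h; apply: fintype.subset_trans h (subsetUl _ _).
have DC : D \subset C -> D \subset B :|: C.
  by move=> h; apply: fintype.subset_trans h (subsetUr _ _).
have := r_ge0 D; move: DB DC.
case: (D \subset B); case: (D \subset C); case: (D \subset B :|: C) => //= DB DC r0;
  by [lra | move: (DB isT) | move: (DC isT)].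
Qed.

Definition tight := [set B in BB | mass B == F B].

(** The union itself is a block that none of the given ones contains. *)
Lemma load_union_gap X : X \subset BB -> trivIset X -> (2 <= #|X|)%N ->
  cover X \in BB -> \sum_(B in X) F B < F (cover X).
Proof.
move=> XB tX X2 WB; set W := cover X in WB *.
have nW C : C \in X -> ~~ (W \subset C).
  move=> CX; apply/negP => WC.
  have [D DX DC] : exists2 D, D \in X & D != C.
    move: X2; rewrite (cardsD1 C) CX ltnS card_gt0 => /set0Pn[D].
    by rewrite !inE => /andP[DC DX]; exists D.
  have /set0Pn[s sD] := building_neq0 BBP (fintype.subsetP XB _ DX).
  have := trivIsetP tX _ _ DX CX DC; rewrite -setI_eq0 => /eqP DC0.
  have := in_set0 s; rewrite -DC0 inE sD /= (fintype.subsetP WC) //.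
  by apply/bigcupP; exists D.
have rW : 0 < r W.
  apply: r_gt0; rewrite ltnNge; apply/negP => W1.
  have [C CX] : exists C, C \in X by apply/set0Pn; rewrite -card_gt0 (ltnW X2).
  move/negP: (nW _ CX); apply; have CW : C \subset W by apply: bigcup_sup.
  have /eqP-> // : C == W.
  rewrite eqEcard CW (leq_trans W1) // card_gt0 (building_neq0 BBP) //.
  exact: (fintype.subsetP XB).
rewrite sum_disjoint_blocks // /load [ltRHS](bigD1 W) /=; last by rewrite WB fintype.subxx.
rewrite -[ltLHS]add0r ltr_leD // big_mkcondr.
under [leRHS]eq_bigl do rewrite -andbA.
rewrite [leRHS]big_mkcondr /=; apply: ler_sum => B BBB.
case: exists_inP => [[C CX BC]|_]; last by case: ifP.
have -> : B \subset W by apply: fintype.subset_trans BC (bigcup_sup _ CX).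
by have -> : B != W by apply: contraTneq BC => ->; apply: nW.
Qed.

(** Two crossing tight blocks, or several disjoint tight blocks with union a
    block, would make the mass of their union too small, by supermodularity. *)
Lemma tight_prenested : prenested BB tight.
Proof.
have tB B : B \in tight -> B \in BB by rewrite inE => /andP[].
have tE B : B \in tight -> mass B = F B by rewrite inE => /andP[_ /eqP].
split; first by apply/fintype.subsetP.
- move=> B C BT CT; case nBC: (B \subset C); first by constructor 1.
  case nCB: (C \subset B); first by constructor 2.
  constructor 3; rewrite -setI_eq0; apply/negPn/negP => BC0.
  have := load_supermodular (tB _ BT) (tB _ CT) BC0 (negbT nBC) (negbT nCB).
  have r0 : 0 < r (B :|: C).
    apply: r_gt0; rewrite ltnNge; apply/negP => h; move/negP: (negbT nCB); apply.
    have BU : B \subset B :|: C := subsetUl _ _.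
    have : B == B :|: C.
      rewrite eqEcard BU (leq_trans h) // card_gt0.
      by rewrite (building_neq0 BBP) // tB.
    by move/eqP=> ->; apply: subsetUr.
  have := load_le_mass (B :&: C).
  have : F (B :|: C) <= mass (B :|: C) := load_le_mass _.
  have : mass B + mass C = mass (B :|: C) + mass (B :&: C).
    rewrite /mass [X in _ = X + _](big_setID B) /= setUK setDUl setDv set0U.
    by rewrite [X in _ + X = _](big_setID B) /= setIC; lra.
  by rewrite (tE _ BT) (tE _ CT); lra.
- move=> X XT X2 tX; apply/negP => XB.
  have XBB : X \subset BB by apply/fintype.subsetP => B /(fintype.subsetP XT)/tB.
  have := load_union_gap XBB tX X2 XB; rewrite ltNge => /negP; apply.
  apply: le_trans (load_le_mass _) _; rewrite /mass big_trivIset //.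
  by apply: ler_sum => B /(fintype.subsetP XT)/tE <-.
Qed.

End TightBlocks.

(** * The fan of acyclic nested sets *)

Section Weights.
Context {R : realType} {S : finType}.
Variables (BB : {set {set S}}) (BBP : building_set BB).
Implicit Types (lam mu : {set S} -> R) (N M : {set {set S}}) (B C : {set S}).

(** For a singleton [C] this is the value at its element of the combination,
    with coefficients [lam], of the indicator functions of the members of [N];
    for a block [C] it is the minimum of these values over [C] if [N] is nested
    and [lam] is positive. *)
Definition weight lam N C := \sum_(B in N | C \subset B) lam B.

Lemma weight_anti lam N C C' : (forall B, B \in N -> 0 < lam B) ->
  C \subset C' -> weight lam N C' <= weight lam N C.
Proof.
move=> lam0 CC'; rewrite /weight 2!big_mkcondr; apply: ler_sum => B /lam0 l0.
case: ifP => [/(fintype.subset_trans CC')->//|_].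
by case: ifP => // _; apply: ltW.
Qed.

Lemma weight_generic lam N C s : s \in C ->
  (forall B, B \in N -> s \in B -> C \subset B) ->
  weight lam N C = weight lam N [set s].
Proof.
move=> sC gen; apply: eq_bigl => B; case BN: (B \in N) => //=.
rewrite sub1set; apply/idP/idP => [CB|]; first exact: (fintype.subsetP CB).
exact: gen.
Qed.

Lemma generic_pointP N C : prenested BB N -> C \in BB ->
  exists2 s, s \in C & forall B, B \in N -> s \in B -> C \subset B.
Proof.
move=> NP CB; have /subsetPn[s sC sN] := generic_point BBP NP CB.
exists s => // B BN sB; apply: contraNT sN => CB'.
by apply/bigcupP; exists B; rewrite ?inE ?BN.
Qed.

Lemma weight_le lam mu N M C : prenested BB N -> C \in BB ->
  (forall B, B \in M -> 0 < mu B) ->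
  (forall s, weight lam N [set s] = weight mu M [set s]) ->
  weight mu M C <= weight lam N C.
Proof.
move=> NP CB mu0 eqw; have [s sC gen] := generic_pointP NP CB.
by rewrite (weight_generic lam sC gen) eqw weight_anti // sub1set.
Qed.

(** The weights of blocks are determined by those of elements, as minima over
    the block.  Given [B] in [N], the smallest member of [M] containing [B] has
    the same weight as [B] for [M], hence for [N], which forces it to be
    contained in [B]. *)
Lemma weight_inj_sub lam mu N M : prenested BB N -> prenested BB M ->
  (forall B, B \in N -> 0 < lam B) -> (forall B, B \in M -> 0 < mu B) ->
  (forall s, weight lam N [set s] = weight mu M [set s]) -> N \subset M.
Proof.
move=> NP MP lam0 mu0 eqw.
have eqW C : C \in BB -> weight lam N C = weight mu M C.
  move=> CB; apply/eqP; rewrite eq_le; apply/andP; split; last exact: weight_le.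
  by apply: weight_le => // s.
have [NBB _ _] := NP; have [MBB lamM _] := MP.
apply/fintype.subsetP => B BN; have BBB := fintype.subsetP NBB _ BN.
have wB : 0 < weight mu M B.
  rewrite -eqW // /weight (bigD1 B) /=; last by rewrite BN fintype.subxx.
  by rewrite ltr_wpDr ?lam0 // sumr_ge0 // => C /andP[/andP[/lam0/ltW]].
have [C0 C0P] : exists C, (C \in M) && (B \subset C).
  apply/existsP; apply: contraTT wB; rewrite negb_exists => /forallP noC.
  by rewrite /weight big_pred0 ?ltxx // => C; apply/negbTE/noC.
have [C /minsetP[/andP[CM BC] Cmin] _] :=
  @minset_exists _ (fun C => (C \in M) && (B \subset C)) _ C0P.
have CBB := fintype.subsetP MBB _ CM.
have wC : weight mu M C = weight mu M B.
  apply: eq_bigl => D; case DM: (D \in M) => //=; apply/idP/idP => [|BD].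
    exact: fintype.subset_trans.
  have [//|DC|CD] := lamM _ _ CM DM; first by rewrite (Cmin D) // DM.
  have /set0Pn[s sB] := building_neq0 BBP BBB; move: CD; rewrite -setI_eq0.
  move=> /eqP CD; have := in_set0 s.
  by rewrite -CD inE (fintype.subsetP BC) ?(fintype.subsetP BD).
have CB : C \subset B.
  apply: contraTT isT => nCB; have := wC; rewrite -!eqW // => wE.
  have : weight lam N C < weight lam N B; last by rewrite wE ltxx.
  rewrite /weight [ltRHS](bigD1 B) /=; last by rewrite BN fintype.subxx.
  rewrite -[ltLHS]add0r ltr_leD ?lam0 //.
  rewrite [leRHS](eq_bigl (fun D => (D \in N) && ((B \subset D) && (D != B)))).
    rewrite 2!big_mkcondr /=; apply: ler_sum => D /lam0/ltW l0.
    case: ifP => [CD|_]; last by case: ifP.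
    rewrite (fintype.subset_trans BC CD) /=.
    by case: eqP CD => // ->; rewrite (negPf nCB).
  by move=> D; rewrite andbA.
by have <- : C = B by apply/eqP; rewrite eqEsubset CB BC.
Qed.

Lemma weight_inj lam mu N M : prenested BB N -> prenested BB M ->
  (forall B, B \in N -> 0 < lam B) -> (forall B, B \in M -> 0 < mu B) ->
  (forall s, weight lam N [set s] = weight mu M [set s]) -> N = M.
Proof.
move=> NP MP lam0 mu0 eqw; apply/eqP; rewrite eqEsubset.
by rewrite (weight_inj_sub NP MP lam0 mu0) ?(weight_inj_sub MP NP mu0 lam0).
Qed.

End Weights.

Section AcyclicFan.
Context {R : realType} {S : finType} {d : nat}.
Variables (A : S -> 'rV[R]_d) (BB : {set {set S}}).
Hypothesis BBO : oriented_building_set BB A.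
Implicit Types (N M : {set {set S}}) (B C : {set S}).

Let BBP : building_set BB := proj1 BBO.

Lemma acyclic_sub N N' : acyclic A N -> N' \subset N -> acyclic A N'.
Proof.
move=> Nac N'N [c [X [cc XN' c1 c2]]]; apply: Nac; exists c, X; split => //.
exact: fintype.subset_trans XN' N'N.
Qed.

(** Acyclicity provides generic points of both signs on every circuit: if all
    generic points had the same sign, the circuit or its opposite would violate
    acyclicity for the members that do not contain it. *)
Lemma circuit_generic_point N c : prenested BB N -> acyclic A N -> circuit A c ->
  exists2 s, s \in c.1 & forall B, B \in N -> s \in B -> circuit_support c \subset B.
Proof.
move=> NP Nac cc; have CB := proj2 BBO _ cc.
have := generic_point BBP NP CB; set N' := finset _ => nCN'.
have N'N : N' \subset N by apply/fintype.subsetP => B; rewrite inE => /andP[].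
have /subsetPn[s sc sN'] : ~~ (c.1 \subset cover N').
  apply/negP => c1N'; apply: Nac; exists (c.2, c.1), N'; split => //.
    exact: circuit_opp.
  by apply: contraNN nCN' => /= c2N'; rewrite subUset c1N'.
exists s => // B BN sB; apply: contraNT sN' => CB'.
by apply/bigcupP; exists B; rewrite ?inE ?BN.
Qed.

(** The relative interiors of the cones spanned by acyclic nested sets are
    disjoint.  The difference of the two weights of a common point is a
    dependence.  If it were nonzero, take a circuit conforming to it, with
    support [C].  The minimum over [C] of each weight is attained at a point of
    either sign: a positive one shows that the first minimum exceeds the second
    one, and a negative one shows the converse. *)
Lemma acyclic_cone_inj (lam mu : {set S} -> R) N M :
  prenested BB N -> prenested BB M -> acyclic A N -> acyclic A M ->
  (forall B, B \in N -> 0 < lam B) -> (forall B, B \in M -> 0 < mu B) ->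
  \sum_(B in N) lam B *: (\sum_(b in B) A b) =
  \sum_(B in M) mu B *: (\sum_(b in B) A b) -> N = M.
Proof.
move=> NP MP Nac Mac lam0 mu0 eqNM.
have sumE nu (X : {set {set S}}) : \sum_(B in X) nu B *: (\sum_(b in B) A b) =
    \sum_s weight nu X [set s] *: A s.
  under eq_bigr do rewrite scaler_sumr.
  rewrite (exchange_big_dep xpredT) //=; apply: eq_bigr => s _.
  by rewrite scaler_suml; apply: eq_bigl => B; rewrite sub1set.
pose delta := [ffun s => weight lam N [set s] - weight mu M [set s]].
have delta_dep : dependence A delta.
  rewrite /dependence; under eq_bigr do rewrite ffunE scalerBl.
  by rewrite sumrB -!sumE eqNM subrr.
have [delta0|delta0] := eqVneq delta 0.
  apply: (weight_inj BBP NP MP lam0 mu0) => s; apply/eqP.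
  by rewrite -subr_eq0; move/ffunP: delta0 => /(_ s); rewrite !ffunE => ->.
have [c [cc c1 c2]] := conformal_circuit delta_dep delta0.
pose C := circuit_support c.
have [s sc sgen] := circuit_generic_point NP Nac cc.
have [t tc tgen] := circuit_generic_point MP Mac (circuit_opp cc).
have sC : s \in C by rewrite inE sc.
have tC : t \in C by rewrite inE tc orbT.
have tgen' B : B \in M -> t \in B -> C \subset B.
  by move=> BM tB; rewrite /C /circuit_support setUC; apply: tgen.
have : weight mu M C < weight lam N C.
  rewrite (weight_generic lam sC sgen).
  apply: le_lt_trans (_ : weight mu M [set s] < _).
    by apply: weight_anti => //; rewrite sub1set.
  by have := fintype.subsetP c1 _ sc; rewrite inE ffunE subr_gt0.
have : weight lam N C < weight mu M C.
  rewrite (weight_generic mu tC tgen').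
  apply: le_lt_trans (_ : weight lam N [set t] < _).
    by apply: weight_anti => //; rewrite sub1set.
  by have := fintype.subsetP c2 _ tc; rewrite inE ffunE subr_lt0.
by move=> h1 h2; have := lt_trans h1 h2; rewrite ltxx.
Qed.

End AcyclicFan.

(** * Tight sets are acyclic *)

Section TightAcyclic.
Context {R : realType} {S : finType} {d : nat}.
Variables (A : S -> 'rV[R]_d) (BB : {set {set S}}).
Hypothesis A_loopless : forall s : S, A s <> 0.
Hypothesis BBO : oriented_building_set BB A.
Implicit Types (N X : {set {set S}}) (B C U : {set S}) (y : 'rV[R]_d).

Let BBP : building_set BB := proj1 BBO.

Definition tight_blocks y := [set B in BB | gbar BB A B y == 0].

Lemma gbarE B y : gbar BB A B y =
  mass (fun s => dotp (A s) y) B - load BB (rho BB A) B.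
Proof. by rewrite /gbar dotp_suml. Qed.

Lemma tight_blocksE y :
  tight_blocks y = tight BB (rho BB A) (fun s => dotp (A s) y).
Proof. by apply/setP => B; rewrite !inE gbarE subr_eq0. Qed.

Lemma max_circuit_ratio_ge1 : 1 <= max_circuit_ratio A.
Proof. exact: bigmax_ge_id. Qed.

Lemma radius_ge1 (s : S) : 1 <= radius BB A.
Proof.
have [_ /(_ s) sB _] := BBP.
rewrite /radius -[leLHS]mulr1 ler_pM ?max_circuit_ratio_ge1 //.
by rewrite ler1n card_gt0; apply/set0Pn; exists [set s].
Qed.

Lemma radius_ge0 : 0 <= radius BB A.
Proof.
by rewrite mulr_ge0 // (le_trans ler01 max_circuit_ratio_ge1).
Qed.

Lemma rho_ge0 B : 0 <= rho BB A B.
Proof. by rewrite /rho; case: ifP => // _; rewrite exprn_ge0 ?radius_ge0. Qed.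

Lemma rho_gt0 B : (2 <= #|B|)%N -> 0 < rho BB A B.
Proof.
move=> B2; rewrite /rho B2 exprn_gt0 //.
have /set0Pn[s _] : B != set0 by rewrite -card_gt0 ltnW.
exact: lt_le_trans ltr01 (radius_ge1 s).
Qed.

Lemma load_ge0 B : 0 <= load BB (rho BB A) B.
Proof. by rewrite sumr_ge0 // => ? _; apply: rho_ge0. Qed.

Section Point.
Variable y : 'rV[R]_d.
Hypothesis yP : forall B, B \in BB -> 0 <= gbar BB A B y.

Let x s := dotp (A s) y.

Lemma point_ge0 s : 0 <= x s.
Proof.
have [_ /(_ s)/yP + _] := BBP; rewrite gbarE subr_ge0 /mass big_set1.
exact: le_trans (load_ge0 _).
Qed.

Lemma point_load_le B : B \in BB -> load BB (rho BB A) B <= mass x B.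
Proof. by move=> /yP; rewrite gbarE subr_ge0. Qed.

Lemma tight_blocks_prenested : prenested BB (tight_blocks y).
Proof.
rewrite tight_blocksE; apply: tight_prenested => //.
- exact: rho_ge0.
- exact: rho_gt0.
- exact: point_ge0.
- exact: point_load_le.
Qed.

(** A circuit violating acyclicity, together with the maximal members of the
    violating subfamily that it meets, forms a block [W].  The positive part of
    the circuit must have mass at least [rho BB A W]; but its mass is at most
    [max_circuit_ratio A] times that of these tight blocks, which is a sum of
    fewer than [#|BB|] values of [rho] at smaller blocks. *)
Lemma tight_blocks_acyclic : acyclic A (tight_blocks y).
Proof.
move=> [c [N' [cc N'T c1 c2]]]; set T := tight_blocks y in N'T.
pose C := circuit_support c; have CB : C \in BB := proj2 BBO _ cc.
have N'P := prenested_sub tight_blocks_prenested N'T.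
pose X := [set B in kappa N' | B :&: C != set0].
have Xk : X \subset kappa N' by apply/fintype.subsetP => B; rewrite inE => /andP[].
have XN' := fintype.subset_trans Xk (kappa_sub N').
have XT := fintype.subset_trans XN' N'T.
have XB : X \subset BB.
  by apply: fintype.subset_trans XT _; apply/fintype.subsetP => B; rewrite inE => /andP[].
have tX := trivIsetS Xk (trivIset_kappa N'P).
have c2X : c.2 \subset cover X.
  apply/fintype.subsetP => s sc; have := fintype.subsetP c2 s sc.
  rewrite -cover_kappa => /bigcupP[B Bk sB]; apply/bigcupP; exists B => //.
  by rewrite inE Bk; apply/set0Pn; exists s; rewrite !inE sB sc orbT.
pose W := C :|: cover X.
have WB : W \in BB.
  by apply: (union_meeting BBP) => // B; rewrite inE => /andP[].
have W2 : (2 <= #|W|)%N.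
  exact: leq_trans (circuit_card2 A_loopless cc) (subset_leq_card (subsetUl _ _)).
have nWX B : B \in X -> ~~ (W \subset B).
  move=> BX; apply: contraNN c1 => WB'.
  apply: fintype.subset_trans (_ : B \subset _).
    by apply: fintype.subset_trans WB'; rewrite /W /C /circuit_support -setUA subsetUl.
  exact: bigcup_sup (fintype.subsetP XN' _ BX).
have XW B : B \in X -> B \subset W.
  by move=> BX; apply: fintype.subset_trans (bigcup_sup _ BX) (subsetUr _ _).
pose E := \sum_(B in BB | [exists B' in X, B \subset B']) rho BB A B.
have XE : mass x (cover X) = E.
  rewrite /E -(sum_disjoint_blocks BBP) // /mass big_trivIset //.
  apply: eq_bigr => B /(fintype.subsetP XT); rewrite inE gbarE subr_eq0.
  by move=> /andP[_ /eqP].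
have loadW : rho BB A W + E <= load BB (rho BB A) W.
  rewrite /load [leRHS](bigD1 W) /=; last by rewrite WB fintype.subxx.
  rewrite lerD2l /E.
  rewrite [leRHS](eq_bigl (fun B => (B \in BB) && ((B \subset W) && (B != W)))).
    rewrite 2!big_mkcondr /=; apply: ler_sum => B _; have := rho_ge0 B.
    case: exists_inP => [[B' B'X BB']|_]; last by case: ifP.
    rewrite (fintype.subset_trans BB' (XW _ B'X)) /=.
    by case: eqP BB' => // ->; rewrite (negPf (nWX _ B'X)).
  by move=> B; rewrite andbA.
have massW : mass x W <= mass x c.1 + E.
  rewrite -XE; apply: (@le_trans _ _ (mass x (c.1 :|: cover X))).
    apply: mass_sub => [|]; first exact: point_ge0.
    by rewrite /W /C /circuit_support -setUA (setUidPr c2X).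
  rewrite /mass (big_setID c.1) /= setUK lerD2l setDUl setDv set0U.
  apply: mass_sub; first exact: point_ge0.
  exact: subsetDl.
have ratio : mass x c.1 <= max_circuit_ratio A * E.
  apply: le_trans (circuit_ratio_bound cc point_ge0 _) _.
    move=> delta ddep; rewrite -[RHS](dotp0l y) -ddep dotp_suml.
    by apply: eq_bigr => s _; rewrite dotpZl.
  rewrite ler_wpM2l ?(le_trans ler01 max_circuit_ratio_ge1) // -XE.
  by apply: mass_sub => //; exact: point_ge0.
have [s sC] : exists s, s \in W by apply/set0Pn; rewrite -card_gt0 ltnW.
have R1 := radius_ge1 s.
have R0 : 0 < radius BB A := lt_le_trans ltr01 R1.
have Elt : E < #|BB|%:R * radius BB A ^+ #|W|.-1.
  apply: (@le_lt_trans _ _ (\sum_(B in BB :\ W) radius BB A ^+ #|W|.-1)).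
    rewrite /E [leRHS](eq_bigl (fun B => (B \in BB) && (B != W))); last first.
      by move=> B; rewrite !inE andbC.
    rewrite 2!big_mkcondr /=; apply: ler_sum => B _.
    case: exists_inP => [[B' B'X BB']|_]; last first.
      by case: ifP => // _; rewrite exprn_ge0 ?radius_ge0.
    have -> : B != W by apply: contraTneq BB' => ->; apply: nWX.
    rewrite /rho; case: ifP => _; last by rewrite exprn_ge0 ?radius_ge0.
    rewrite ler_weXn2l // -ltnS prednK ?(ltnW W2) //.
    apply: leq_ltn_trans (subset_leq_card BB') _; apply: proper_card.
    by rewrite properE XW ?nWX.
  rewrite sumr_const -[ltLHS]mulr_natl ltr_pM2r ?exprn_gt0 // ltr_nat.
  by rewrite [ltnRHS](cardsD1 W) WB.
have rhoW : rho BB A W =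
    max_circuit_ratio A * (#|BB|%:R * radius BB A ^+ #|W|.-1).
  rewrite /rho W2 -[in LHS](prednK (ltnW W2)) exprS {1}/radius.
  by rewrite mulrAC mulrA [max_circuit_ratio A * _]mulrC mulrAC.
suff : rho BB A W + E < rho BB A W + E by rewrite ltxx.
apply: le_lt_trans loadW (le_lt_trans (point_load_le WB) _).
apply: le_lt_trans massW _; rewrite ltrD2r; apply: le_lt_trans ratio _.
by rewrite rhoW ltr_pM2l // (lt_le_trans ltr01 max_circuit_ratio_ge1).
Qed.

End Point.
End TightAcyclic.

(** * Realizing acyclic nested sets *)

Section Realization.
Context {R : realType} {S : finType} {d : nat}.
Variables (A : S -> 'rV[R]_d) (BB : {set {set S}}).
Hypothesis A_loopless : forall s : S, A s <> 0.
Hypothesis BBO : oriented_building_set BB A.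
Implicit Types (N M : {set {set S}}) (B C : {set S}) (y z : 'rV[R]_d).

Let BBP : building_set BB := proj1 BBO.
Let u B : 'rV[R]_d := \sum_(b in B) A b.

(** By the lemma of Farkas, if no linear form is nonnegative on the whole
    configuration and positive on [A s], then there is a nonnegative dependence
    with [s] in its support.  A circuit conforming to it has an empty negative
    part, and violates acyclicity for the empty subfamily. *)
Lemma positive_form N : acyclic A N -> exists y, forall s, 0 < dotp (A s) y.
Proof.
move=> Nac.
have zex s : exists z, (forall t, 0 <= dotp (A t) z) /\ 0 < dotp (A s) z.
  have [[mu mu0 sE]|[z z0]] := farkas_alt [set: S] A (- A s); last first.
    by rewrite dotpNl oppr_lt0 => zs; exists z; split=> // t; apply: z0.
  pose delta := [ffun t => mu t + (t == s)%:R].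
  have delta_ge0 t : 0 <= delta t by rewrite ffunE addr_ge0.
  have delta_dep : dependence A delta.
    rewrite /dependence; under eq_bigr do rewrite ffunE scalerDl.
    rewrite big_split /= (eq_bigl [in [set: S]]) -?sE => [|t]; last by rewrite inE.
    rewrite (bigD1 s) //= eqxx scale1r big1 ?addr0 ?addNr // => t /negPf->.
    by rewrite scale0r.
  have delta0 : delta != 0.
    apply/eqP => /ffunP/(_ s); rewrite !ffunE eqxx mulr1n.
    by have := mu0 s; move=> + h; rewrite (_ : mu s = -1) ?lerN10 //; lra.
  have [c [cc _ c2]] := conformal_circuit delta_dep delta0.
  have c20 : c.2 = set0.
    apply/setP => t; rewrite inE; apply/negP => /(fintype.subsetP c2).
    by rewrite inE ltNge delta_ge0.
  case: Nac; exists c, set0; split => //; first exact: sub0set.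
    rewrite /cover big_set0 subset0; apply/eqP => c10.
    have := circuit_card2 A_loopless cc.
    by rewrite /circuit_support c10 c20 setU0 cards0.
  by rewrite c20 sub0set.
have [z zP] := choice zex; exists (\sum_s z s) => s.
rewrite dotp_sumr (bigD1 s) //= ltr_wpDr ?(proj2 (zP s)) // sumr_ge0 // => t _.
exact: (proj1 (zP t)).
Qed.

Lemma feasible_exists N : acyclic A N ->
  exists y, feasible BB u (load BB (rho BB A)) y.
Proof.
move=> /positive_form[y y0].
have uy B : B \in BB -> 0 < dotp (u B) y.
  move=> /(building_neq0 BBP)/set0Pn[s sB].
  rewrite dotp_suml (bigD1 s) //= ltr_wpDr // sumr_ge0 // => t _.
  exact: ltW.
pose q B := load BB (rho BB A) B / dotp (u B) y.
have q0 B : B \in BB -> 0 <= q B.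
  by move=> BBB; rewrite divr_ge0 ?load_ge0 ?ltW ?uy.
exists ((\sum_(B in BB) q B) *: y) => B BBB.
rewrite dotpZr -ler_pdivrMr ?uy // (bigD1 B) //= lerDl sumr_ge0 // => C.
by move=> /andP[/q0].
Qed.

Lemma feasible_gbar y : feasible BB u (load BB (rho BB A)) y <->
  forall B, B \in BB -> 0 <= gbar BB A B y.
Proof. by split=> h B /h; rewrite subr_ge0. Qed.

Lemma gbar_eq0 B y : (gbar BB A B y = 0) <-> dotp (u B) y = load BB (rho BB A) B.
Proof.
split=> [/eqP|h]; first by rewrite subr_eq0 => /eqP.
by apply/eqP; rewrite subr_eq0; apply/eqP.
Qed.

(** Minimize the sum of the functionals of the members of [N]: the multipliers
    of a minimizer are supported by its tight blocks, and express a point of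
    the cone of [N], so that this support is [N]. *)
Lemma exists_tight_on N : prenested BB N -> acyclic A N ->
  exists2 y, feasible BB u (load BB (rho BB A)) y & N \subset tight_blocks A BB y.
Proof.
move=> NP Nac; have [NBB _ _] := NP.
pose lam B : R := (B \in N)%:R.
have lam0 B : 0 <= lam B by rewrite ler0n.
have [y [mu [yP mu0 muE mu_tight]]] :=
  complementary_optimum (feasible_exists Nac) lam0 erefl.
exists y => //; have yP' := (feasible_gbar y).1 yP.
pose M := [set B in BB | 0 < mu B].
have MT : M \subset tight_blocks A BB y.
  apply/fintype.subsetP => B; rewrite !inE => /andP[BBB muB]; rewrite BBB /=.
  by apply/eqP/gbar_eq0/mu_tight.
have MP := prenested_sub (tight_blocks_prenested BBO yP') MT.
have Mac := acyclic_sub (tight_blocks_acyclic A_loopless BBO yP') MT.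
suff -> : N = M by [].
apply: (acyclic_cone_inj BBO NP MP Nac Mac (lam := fun=> 1) (mu := mu)) => //.
  by move=> B; rewrite inE => /andP[].
by rewrite -scaler_sumr scale1r -(sum_indicator _ NBB) muE sum_positive_part.
Qed.

(** If there were no such direction, a positive combination of the functionals
    of [N] would equal a positive combination of functionals of members of [T]
    that also involves [B0], against the disjointness of the cones. *)
Lemma leaving_direction N T B0 : prenested BB T -> acyclic A T ->
  N \subset T -> B0 \in T -> B0 \notin N ->
  exists z, [/\ forall B, B \in T -> 0 <= dotp (u B) z,
    forall B, B \in N -> dotp (u B) z = 0 & 0 < dotp (u B0) z].
Proof.
move=> TP Tac NT B0T B0N; pose w := \sum_(B in N) u B.
(* The constraint indexed by None forces the functionals of N to vanish. *)
pose P : {set option {set S}} := None |: [set Some B | B in T].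
pose v (o : option {set S}) := if o is Some B then u B else - w.
have [[nu nu0 nuE]|[z zP]] := farkas_alt P v (- u B0); last first.
  rewrite dotpNl oppr_lt0 => zB0.
  have zT B : B \in T -> 0 <= dotp (u B) z.
    by move=> BT; apply: (zP (Some B)); rewrite !inE /= imset_f.
  exists z; split => // B BN; have := zP None; rewrite !inE => /(_ isT).
  have zN C : C \in N -> 0 <= dotp (u C) z by move/(fintype.subsetP NT)/zT.
  rewrite dotpNl oppr_ge0 dotp_suml => w0; apply/eqP.
  have /eqP : \sum_(B in N) dotp (u B) z = 0.
    by apply/eqP; rewrite eq_le w0 sumr_ge0.
  by rewrite psumr_eq0 // => /allP/(_ B (mem_index_enum _)); rewrite BN.
pose t := nu None; pose mu B := (B \in N)%:R + (B == B0)%:R + nu (Some B).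
pose M := [set B in T | 0 < mu B].
have MT : M \subset T by apply/fintype.subsetP => B; rewrite inE => /andP[].
have mu0 B : 0 <= mu B by rewrite !addr_ge0.
have : N = M.
  apply: (acyclic_cone_inj BBO (prenested_sub TP NT) (prenested_sub TP MT)
    (acyclic_sub Tac NT) (acyclic_sub Tac MT) (lam := fun=> 1 + t) (mu := mu)).
  - by move=> B _; rewrite ltr_wpDr // nu0.
  - by move=> B; rewrite inE => /andP[].
  rewrite -scaler_sumr -/(u _) -/w scalerDl scale1r.
  transitivity (\sum_(B in T) mu B *: u B); last first.
    exact: sum_positive_part.
  have -> : t *: w = u B0 + \sum_(B in T) nu (Some B) *: u B.
    move: nuE; rewrite big_setU1 /=; last by apply/imsetP => -[].
    rewrite big_imset /=; last by move=> B C _ _ [].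
    rewrite scalerN -/t => /eqP; rewrite eq_sym addrC subr_eq => /eqP->.
    by rewrite addNKr.
  under [RHS]eq_bigr do rewrite !scalerDl.
  rewrite !big_split /= -addrA; congr (_ + (_ + _)).
    by rewrite sum_indicator.
  rewrite (bigD1 B0) //= eqxx scale1r big1 ?addr0 //.
  by move=> B /andP[_ /negPf->]; rewrite scale0r.
move/setP/(_ B0); rewrite (negPf B0N) inE B0T /= => /esym/negP[].
by rewrite /mu eqxx (negPf B0N) add0r ltr_wpDr.
Qed.

Lemma realize_nested N : nested_set BB N -> acyclic A N ->
  exists2 y, acyclonestohedron BB A y & tight_blocks A BB y = N.
Proof.
move=> /nested_setE[NP kN] Nac; have [NBB _ _] := NP.
have [y yP NT] := exists_tight_on NP Nac.
have yP' := (feasible_gbar y).1 yP; set T := tight_blocks A BB y in NT.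
have TP := tight_blocks_prenested BBO yP'.
have Tac := tight_blocks_acyclic A_loopless BBO yP'.
have zex B0 : exists z, [/\ forall B, B \in T -> 0 <= dotp (u B) z,
    forall B, B \in N -> dotp (u B) z = 0 &
    B0 \in T -> B0 \notin N -> 0 < dotp (u B0) z].
  have [/andP[B0T B0N]|/negP nB0] := boolP ((B0 \in T) && (B0 \notin N)).
    by have [z [z1 z2 z3]] := leaving_direction TP Tac NT B0T B0N; exists z.
  exists 0; split => [B _|B _|B0T B0N]; rewrite ?[dotp _ 0]dotpC ?dotp0l //.
  by case: nB0; rewrite B0T.
(* A single direction in which all blocks outside N cease to be tight. *)
have [z zP] := choice zex; pose z0 := \sum_(B in T) z B.
have z0T B : B \in T -> 0 <= dotp (u B) z0.
  by move=> BT; rewrite dotp_sumr sumr_ge0 // => C _; have [->] := zP C.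
have z0N B : B \in N -> dotp (u B) z0 = 0.
  move=> BN; rewrite dotp_sumr; apply: big1 => C _.
  by have [_ zC _] := zP C; apply: zC.
have z0pos B : B \in T -> B \notin N -> 0 < dotp (u B) z0.
  move=> BT BN; rewrite dotp_sumr (bigD1 B) //= ltr_wpDr //.
    by rewrite sumr_ge0 // => C _; have [->] := zP C.
  by have [_ _ zB] := zP B; apply: zB.
have [B BBB tB|e [e0 yzP yzT]] := @feasible_step _ _ _ _ _ _ y z0 yP.
  by apply: z0T; rewrite inE BBB; apply/eqP/gbar_eq0.
have [y' y'span y'E] := project_to_span A (y + e *: z0).
have gE B : gbar BB A B y' = gbar BB A B (y + e *: z0).
  by rewrite /gbar !dotp_suml; congr (_ - _); apply: eq_bigr => b _.
have TE : tight_blocks A BB y' = N.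
  apply/setP => B; rewrite inE gE; apply/andP/idP => [[BBB /eqP/gbar_eq0 tB]|BN].
    have [tyB zB] := yzT _ BBB tB.
    apply: contraTT isT => BN; have BT : B \in T by rewrite inE BBB; apply/eqP/gbar_eq0.
    by have := z0pos _ BT BN; rewrite zB ltxx.
  split; first exact: (fintype.subsetP NBB).
  apply/eqP/gbar_eq0; rewrite dotpDr dotpZr z0N // mulr0 addr0; apply/gbar_eq0.
  by have := fintype.subsetP NT _ BN; rewrite inE => /andP[_ /eqP].
exists y' => //; split => // B.
  by move=> /(fintype.subsetP kN); rewrite -TE inE => /andP[_ /eqP].
by move=> BBB; rewrite gE; apply: (feasible_gbar _).1 yzP _ BBB.
Qed.

End Realization.

(** * Faces *)

Section Faces.
Context {R : realType} {S : finType} {d : nat}.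
Variables (A : S -> 'rV[R]_d) (BB : {set {set S}}).
Implicit Types (K N : {set {set S}}) (B : {set S}) (y z : 'rV[R]_d).

Let Q := acyclonestohedron BB A.
Let T y := tight_blocks A BB y.

Definition tight_face K : set 'rV[R]_d :=
  fun y => Q y /\ forall B, B \in K -> gbar BB A B y = 0.

Lemma kappa_tight y : Q y -> kappa BB \subset T y.
Proof.
move=> [_ yk _]; apply/fintype.subsetP => B Bk.
by rewrite inE yk // eqxx (fintype.subsetP (kappa_sub BB)).
Qed.

Lemma tight_faceP K y : K \subset BB -> tight_face K y <-> Q y /\ K \subset T y.
Proof.
move=> KBB; split=> -[Qy yK]; split => //.
  by apply/fintype.subsetP => B BK; rewrite inE yK // eqxx (fintype.subsetP KBB).
by move=> B /(fintype.subsetP yK); rewrite inE => /andP[_ /eqP].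
Qed.

Lemma tight_face_setD K y : tight_face (K :\: kappa BB) y <-> tight_face K y.
Proof.
split=> -[Qy yK]; split=> // B BK; last by apply: yK; move: BK; rewrite inE => /andP[].
have [Bk|Bk] := boolP (B \in kappa BB); first by have [_ -> ] := Qy.
by apply: yK; rewrite inE Bk.
Qed.

Lemma tight_face_face K : K \subset BB -> face Q (tight_face K).
Proof.
move=> KBB; pose v := \sum_(B in K) \sum_(b in B) A b.
pose t := \sum_(B in K) \sum_(B' in BB | B' \subset B) rho BB A B'.
have vE y : dotp v y - t = \sum_(B in K) gbar BB A B y.
  by rewrite dotp_suml -sumrB.
have g0 y B : Q y -> B \in K -> 0 <= gbar BB A B y.
  by move=> [_ _ yP] /(fintype.subsetP KBB)/yP.
exists v, t; split => [y Qy|].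
  by rewrite -subr_ge0 vE sumr_ge0 // => B; apply: g0.
apply/funext => y; apply/propext; split=> -[Qy yK]; split => //.
  by apply/eqP; rewrite -subr_eq0 vE big1.
move=> B BK; have /eqP : \sum_(B in K) gbar BB A B y = 0 by rewrite -vE yK subrr.
rewrite psumr_eq0 => [/allP/(_ B (mem_index_enum _))|C CK]; last exact: g0.
by rewrite BK => /eqP.
Qed.

Lemma gbar_line B y z e :
  gbar BB A B (y + e *: z) = gbar BB A B y + e * dotp (\sum_(b in B) A b) z.
Proof. by rewrite /gbar dotpDr dotpZr addrAC. Qed.

Lemma gbar_sub B y z :
  dotp (\sum_(b in B) A b) (y - z) = gbar BB A B y - gbar BB A B z.
Proof. by rewrite /gbar dotpDr dotpNr opprB addrA subrK. Qed.

(** A point of [F] with fewest tight blocks lies in the relative interior of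
    [F]: segments from it to points sharing its tight blocks can be prolonged
    beyond it, and its midpoint with any point of [F] has no fewer tight
    blocks. *)
Lemma face_tight F : nonempty_faces Q F ->
  exists2 y, Q y & F = tight_face (T y).
Proof.
move=> [[v [t [vt ->]]] [y1 [Qy1 vy1]]].
pose good k := `[< exists y, [/\ Q y, dotp v y = t & #|T y| = k] >].
have exgood : exists k, good k by exists #|T y1|; apply/asboolP; exists y1.
case: (ex_minnP exgood) => k /asboolP[y [Qy vy <-]] ymin.
have TBB w : T w \subset BB by apply/fintype.subsetP => B; rewrite inE => /andP[].
exists y => //; apply/funext => z; apply/propext.
rewrite (tight_faceP _ (TBB y)); split=> [[Qz vz]|[Qz Tyz]]; split => //.
  pose w := y + 2^-1 *: (z - y).
  have [yspan yk yP] := Qy; have [zspan zk zP] := Qz.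
  have gw B : gbar BB A B w = 2^-1 * (gbar BB A B y + gbar BB A B z).
    by rewrite gbar_line gbar_sub; lra.
  have Qw : Q w.
    split; first by rewrite rpredD ?rpredZ ?rpredB.
      by move=> B Bk; rewrite gw yk // zk // addr0 mulr0.
    by move=> B BBB; rewrite gw mulr_ge0 ?invr_ge0 ?ler0n // addr_ge0 ?yP ?zP.
  have Twy : T w \subset T y :&: T z.
    apply/fintype.subsetP => B; rewrite !inE => /andP[BBB]; rewrite gw BBB /=.
    have := yP _ BBB; have := zP _ BBB => z0 y0 /eqP h.
    by apply/andP; split; apply/eqP; lra.
  have : (#|T y| <= #|T w|)%N.
    apply: ymin; apply/asboolP; exists w; split=> //.
    by rewrite dotpDr dotpZr dotpDr dotpNr vy vz subrr mulr0 addr0.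
  rewrite (geq_leqif (subset_leqif_card (fintype.subset_trans Twy (subsetIl _ _)))).
  move=> Tyw; apply: fintype.subset_trans (subsetIr _ _).
  exact: fintype.subset_trans Tyw Twy.
have [yspan yk yP] := Qy; have [zspan zk zP] := Qz.
have [B BBB tB|e [e0 yzP _]] := @feasible_step _ _ _ BB (fun B => \sum_(b in B) A b)
    (load BB (rho BB A)) y (y - z) ((feasible_gbar A BB y).2 yP).
  have BT : B \in T y by rewrite inE BBB; apply/eqP/gbar_eq0.
  rewrite gbar_sub; move: (BT) (fintype.subsetP Tyz _ BT); rewrite !inE.
  by move=> /andP[_ /eqP->] /andP[_ /eqP->]; rewrite subrr.
have Qw : Q (y + e *: (y - z)).
  split; first by rewrite rpredD ?rpredZ ?rpredB.
    by move=> B Bk; rewrite gbar_line gbar_sub yk // zk // subrr mulr0 addr0.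
  exact/(feasible_gbar A BB).
have := vt _ Qw; rewrite dotpDr dotpZr dotpDr dotpNr vy lerDl pmulr_rge0 //.
by rewrite subr_ge0 => h; apply/eqP; rewrite eq_le h vt.
Qed.

End Faces.

Theorem theorem8p12 (R : realType) (S : finType) (d : nat)
    (A : S -> 'rV[R]_d) (BB : {set {set S}})
    (A_loopless : forall s : S, A s <> 0%R)
    (BB_oriented : oriented_building_set BB A) :
  iso_polar_boundary (acyclic_nested_complex BB A) (acyclonestohedron BB A).
Proof.
pose Q := acyclonestohedron BB A.
have sub_faces N N' : nested_set BB N -> nested_set BB N' -> acyclic A N' ->
    (tight_face A BB (N' :\: kappa BB) `<=` tight_face A BB (N :\: kappa BB))%classic ->
    N \subset N'.
  move=> [NBB _ _ _] N'P N'ac sub; have [N'BB _ _ _] := N'P.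
  have [y Qy yN'] := realize_nested A_loopless BB_oriented N'P N'ac.
  have /sub/tight_face_setD/(tight_faceP _ _ NBB)[_] :
      tight_face A BB (N' :\: kappa BB) y.
    by apply/tight_face_setD/tight_faceP; rewrite ?yN'.
  by rewrite yN'.
exists (tight_face A BB); split; first split.
- move=> _ [N [NP Nac ->]]; have [NBB _ _ _] := NP; split.
    by apply: tight_face_face; apply: fintype.subset_trans (subsetDl _ _) NBB.
  have [y Qy yN] := realize_nested A_loopless BB_oriented NP Nac.
  by exists y; apply/tight_face_setD/tight_faceP; rewrite ?yN.
- move=> _ _ /set_mem[N [NP Nac ->]] /set_mem[N' [N'P N'ac ->]] eqF.
  congr (_ :\: _); apply/eqP; rewrite eqEsubset.
  by rewrite !sub_faces // ?eqF.
- move=> F /face_tight[y Qy ->]; have [_ _ yP] := Qy.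
  pose N := tight_blocks A BB y.
  exists (N :\: kappa BB); last first.
    by apply/funext => z; apply/propext/tight_face_setD.
  exists N; split => //; last exact: tight_blocks_acyclic.
  by apply/nested_setE; split; [apply: tight_blocks_prenested | apply: kappa_tight].
move=> _ _ [N [NP Nac ->]] [N' [N'P N'ac ->]]; split=> [NN' y [Qy yN']|sub].
  by split=> // B /(fintype.subsetP NN'); apply: yN'.
by apply: setSD; apply: sub_faces.
Qed.
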